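(* Let $X$ be an infinite $T_3$-space (regular and Hausdorff) with no isolated points. Then the following are equivalent: (1) $\pi(X)=\aleph_0$; (2) TWO has a winning strategy in $G_1(\mathcal D,\mathcal D)$; (3) TWO has a winning Markov strategy in $G_1(\mathcal D,\mathcal D)$; (4) $X$ is separable and TWO has a winning strategy in $G_1(\mathcal D,\Omega_x)$ for every $x\in X$; (5) $X$ is separable and TWO has a winning Markov strategy in $G_1(\mathcal D,\Omega_x)$ for every $x\in X$; (6) $X$ has a countable dense subset $D$ such that TWO has a winning strategy in $G_1(\mathcal D,\Omega_x)$ for every $x\in D$; (7) $X$ has a countable dense subset $D$ such that TWO has a winning Markov strategy in $G_1(\mathcal D,\Omega_x)$ for every $x\in D$.
   Context: $\mathcal D$ is the family of all dense subsets of $X$. For $x\in X$, $\Omega_x=\{A\subseteq X: x\in\overline A\setminus A\text{ or }A=\{x\}\}$. A $\pi$-base for $X$ is a family $\mathcal U$ of nonempty open subsets of $X$ such that every nonempty open $V\subseteq X$ contains some $U\in\mathcal U$. $\pi(X)$ is the minimal cardinality of a $\pi$-base for $X$. Game $G_1(\mathcal A,\mathcal B)$: in round $n\in\omega$ ONE plays $A_n\in\mathcal A$ and TWO responds with a point $b_n\in A_n$; TWO wins if $\{b_n:n\in\omega\}\in\mathcal B$, otherwise ONE wins. A strategy for TWO is a function $\sigma$ assigning to each finite sequence $\langle A_0,\dots,A_n\rangle$ of moves of ONE a point of $A_n$; a Markov strategy is a function $\sigma$ assigning to each $A\in\mathcal A$ and $n\in\omega$ a point $\sigma(A,n)\in A$,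 to be played in round $n$ in response to $A$. A (Markov) strategy is winning if TWO wins every play in which TWO follows it. *)

(* Defs.v *)
From mathcomp Require Import all_boot all_classical topology.

Set Implicit Arguments.
Unset Strict Implicit.
Unset Printing Implicit Defensive.

Local Open Scope classical_set_scope.
Local Open Scope card_scope.

Section TopologicalNotions.
Context {X : topologicalType}.

Definition dense_sets : set (set X) := [set A | dense A].

Definition Omega (x : X) : set (set X) :=
  [set A | (closure A `\` A) x \/ A = [set x]].

Definition pi_base (U : set (set X)) : Prop :=
  (forall O, U O -> open O /\ O !=set0) /\
  (forall V, open V -> V !=set0 -> exists2 O, U O & O `<=` V).

End TopologicalNotions.

(* "The pi-weight of X is the cardinality of K": the least cardinality of a
   pi-base is attained and equals that of K. *)
Definition pi_weight_is (X : topologicalType) (T : Type) (K : set T) : Prop :=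
  (exists2 U : set (set X), pi_base U & U #= K) /\
  (forall U : set (set X), pi_base U -> K #<= U).

Definition separable (X : topologicalType) : Prop :=
  exists2 D : set X, countable D & dense D.

Section SelectionGame.
Context {X : Type}.
Implicit Types (AA BB : set (set X)).

(* Strategies are total functions; only their values on nonempty sequences of
   legal moves of ONE, the last move being A in [rcons s A], matter. *)
Definition strategy AA (sigma : seq (set X) -> X) : Prop :=
  forall (s : seq (set X)) (A : set X),
    (forall B, B \in s -> AA B) -> AA A -> A (sigma (rcons s A)).

Definition winning_strategy AA BB (sigma : seq (set X) -> X) : Prop :=
  strategy AA sigma /\
  forall A : nat -> set X, (forall n, AA (A n)) ->
    BB (range (fun n => sigma (mkseq A n.+1))).

Definition markov_strategy AA (sigma : set X -> nat -> X) : Prop :=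
  forall (A : set X) (n : nat), AA A -> A (sigma A n).

Definition winning_markov_strategy AA BB (sigma : set X -> nat -> X) : Prop :=
  markov_strategy AA sigma /\
  forall A : nat -> set X, (forall n, AA (A n)) ->
    BB (range (fun n => sigma (A n) n)).

Definition TWO_wins_G1 AA BB : Prop :=
  exists sigma, winning_strategy AA BB sigma.

Definition TWO_wins_markov_G1 AA BB : Prop :=
  exists sigma, winning_markov_strategy AA BB sigma.

End SelectionGame.

(* Main.v *)
Require Import Defs.
From mathcomp Require Import all_boot all_classical topology.

Set Implicit Arguments.
Unset Strict Implicit.
Unset Printing Implicit Defensive.

Local Open Scope classical_set_scope.

(** Three constructions carry the equivalence.

    From a countable pi-base [u 0, u 1, ...] TWO gets Markov strategies by
    answering the dense set played in round [n] with a point of it in [u n]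
    ([markov_dense_of_pi_base]): the chosen points meet every member of the
    pi-base, so they form a dense set.

    A strategy that produces dense sets becomes one that produces sets in
    [Omega x] when every move [A] of ONE is replaced by [A `\ x]
    ([TWO_wins_Omega], [TWO_wins_markov_Omega]).  Points being closed and
    nonisolated, [A `\ x] is still dense; a dense set missing [x] accumulates
    at [x].  Moreover TWO can only win the dense game if the space is separable,
    since the points played in a single run form a countable dense set.

    The substantial step is [countable_local_pi_base]: let [D] be a countable
    dense set and let TWO have a winning strategy in the game for [Omega x].
    At a given position, let [Y] be the set of the answers that ONE can elicit.
    [D `\` Y] is not dense, because TWO's answer to it would lie in [Y]; so some
    nonempty open set [O] satisfies [O `&` D `<=` Y].  Since [D] is countable,
    countably many positions are enough to realise all the finite sequences of
    answers from [D] that ONE can elicit, and the sets [O] attached to these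
    positions form a countable local pi-base at [x].
    Indeed, if no [O] were contained in a given neighbourhood of [x], then by
    regularity ONE could forever elicit answers from [D] outside a smaller,
    closed neighbourhood of [x], and win.  The union of these local pi-bases over
    the points [x] of [D] is a countable pi-base of the space.

    As a winning Markov strategy is in particular a winning strategy, these
    implications connect the seven conditions. *)

(** * Dense sets in a space whose points are closed and nonisolated *)

Lemma countable_range (T : Type) (A : set T) :
  countable A -> A !=set0 -> exists f : nat -> T, range f = A.
Proof.
move=> /pfcard_geP[->[//]|/surjfunPex[f ->] _]; by exists f.
Qed.

Lemma dense_setT (X : topologicalType) : dense [set: X].
Proof. by move=> O O0 _; rewrite setIT. Qed.

Lemma open_setD1 (X : topologicalType) (x : X) (U : set X) :
  accessible_space X -> open U -> open (U `\ x).
Proof.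
move=> T1 oU; rewrite setDE; apply: openI => //.
exact/closed_openC/accessible_closed_set1.
Qed.

Lemma setD1_neq0 (X : topologicalType) (x : X) (U : set X) :
  isolated [set: X] = set0 -> open U -> U !=set0 -> U `\ x !=set0.
Proof.
move=> noiso oU [y Uy]; apply: contrapT => nU.
have Ux z : U z -> z = x.
  by move=> Uz; apply: contrapT => zx; apply: nU; exists z.
have yx := Ux y Uy; subst y.
suff : isolated [set: X] x by rewrite noiso.
split; first by rewrite inE.
exists U; first exact: open_nbhs_nbhs.
by rewrite setIT; apply/seteqP; split=> [z /Ux //|z /= ->].
Qed.

Lemma dense_setD1 (X : topologicalType) (x : X) (A : set X) :
  accessible_space X -> isolated [set: X] = set0 ->
  dense A -> dense (A `\ x).
Proof.
move=> T1 noiso dA O O0 oO.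
have [y [[Oy yx] Ay]] := dA _ (setD1_neq0 x noiso oO O0)
  (open_setD1 x T1 oO).
by exists y.
Qed.

Lemma Omega_dense (X : topologicalType) (x : X) (A : set X) :
  dense A -> ~ A x -> Omega x A.
Proof.
move=> dA Ax; left; split=> // V.
rewrite nbhsE => -[O [oO Ox] OV].
have [y [Oy Ay]] := dA O (ex_intro _ x Ox) oO.
by exists y; split => //; apply: OV.
Qed.

(** * Countable pi-bases *)

Lemma dense_pi_base (X : topologicalType) (I : Type) (u : I -> set X)
    (b : I -> X) :
  pi_base (range u) -> (forall i, u i (b i)) -> dense (range b).
Proof.
move=> [_ ub] bu O O0 oO; have [_ [i _ <-] uO] := ub O oO O0.
by exists (b i); split; [apply: uO | exists i].
Qed.

(** One point from each member of a finite pi-base would give a finite, hence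
    closed, dense set: the whole space would be finite. *)
Lemma pi_base_infinite (X : topologicalType) (U : set (set X)) :
  infinite_set [set: X] -> accessible_space X -> pi_base U -> infinite_set U.
Proof.
move=> Xinf T1 [Uo Ub] fU; apply: (Xinf).
have [b bP] : exists b : set X -> X, forall O, U O -> O (b O).
  have /infinite_setN0[x0 _] := Xinf.
  suff /choice[b bP] : forall O, exists y, U O -> O y by exists b.
  move=> O; have [UO|nUO] := pselect (U O); last by exists x0.
  by have [_ [y Oy]] := Uo O UO; exists y.
have fb : finite_set (b @` U) by exact: finite_image.
suff -> : [set: X] = b @` U by [].
have /accessible_finite_set_closed/(_ _ fb) cb := T1.
apply/seteqP; split=> // y _; apply: contrapT => nby.
have [O UO Ob] := Ub _ (closed_openC cb) (ex_intro _ y nby).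
by apply: (Ob _ (bP O UO)); exists O.
Qed.

(** All pi-bases being infinite, a countable one has the least cardinality. *)
Lemma pi_weight_natP (X : topologicalType) :
  infinite_set [set: X] -> accessible_space X ->
  pi_weight_is X [set: nat] <->
  exists u : nat -> set X, pi_base (range u).
Proof.
move=> Xinf T1; split=> [[[U pU UN] _]|[u pu]].
  have U0 : U !=set0.
    by apply: infinite_setN0; apply: pi_base_infinite.
  have [|u uU] := countable_range _ U0.
    by move: UN; rewrite card_eq_le => /andP[].
  by exists u; rewrite uU.
split=> [|U pU]; last exact/infiniteP/pi_base_infinite.
exists (range u) => //; apply: eq_card_nat.
  exact/card_image_le.
exact: pi_base_infinite pu.
Qed.

(** * Transformations of strategies *)

Lemma TWO_wins_of_markov (X : Type) (AA BB : set (set X)) :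
  TWO_wins_markov_G1 AA BB -> TWO_wins_G1 AA BB.
Proof.
move=> [m [mA mB]].
exists (fun s => m (last setT s) (size s).-1); split=> [s A _ AA_A|A AA_A].
  by rewrite last_rcons; apply: mA.
have -> : (fun n => m (last setT (mkseq A n.+1)) (size (mkseq A n.+1)).-1) =
          (fun n => m (A n) n).
  by apply/funext => n; rewrite size_mkseq mkseqS last_rcons.
exact: mB.
Qed.

Lemma TWO_wins_Omega (X : topologicalType) (x : X) :
  accessible_space X -> isolated [set: X] = set0 ->
  TWO_wins_G1 (@dense_sets X) (@dense_sets X) ->
  TWO_wins_G1 dense_sets (Omega x).
Proof.
move=> T1 noiso [sg [sgA sgB]].
pose del (A : set X) := A `\ x.
have ddel (A : set X) : dense A -> dense (del A) by exact: dense_setD1.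
have leg (s : seq (set X)) A : (forall B, B \in s -> dense B) -> dense A ->
    del A (sg (map del (rcons s A))).
  move=> ds dA; rewrite map_rcons.
  apply: (sgA (map del s) (del A)); last exact: ddel.
  by move=> B /mapP[C Cs ->]; apply/ddel/ds.
exists (sg \o map del); split=> [s A ds dA|A dA].
  by have [] := leg s A ds dA.
apply: Omega_dense => [|[n _] sx].
  have -> : (fun n => (sg \o map del) (mkseq A n.+1)) =
            (fun n => sg (mkseq (del \o A) n.+1)).
    by apply/funext => n /=; rewrite /mkseq -map_comp.
  by apply: sgB => n; apply/ddel/dA.
have ds B : B \in mkseq A n -> dense B by move=> /mapP[i _ ->]; apply: dA.
by have [_] := leg _ _ ds (dA n); rewrite -mkseqS; apply.
Qed.

Lemma TWO_wins_markov_Omega (X : topologicalType) (x : X) :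
  accessible_space X -> isolated [set: X] = set0 ->
  TWO_wins_markov_G1 (@dense_sets X) (@dense_sets X) ->
  TWO_wins_markov_G1 dense_sets (Omega x).
Proof.
move=> T1 noiso [m [mA mB]].
have ddel (A : set X) : dense A -> dense (A `\ x) by exact: dense_setD1.
exists (fun A n => m (A `\ x) n); split=> [A n dA|A dA].
  by have [] := mA (A `\ x) n (ddel _ dA).
apply: Omega_dense => [|[n _] mx].
  by apply: (mB (fun n => A n `\ x)) => n; apply/ddel/dA.
by have [_] := mA (A n `\ x) n (ddel _ (dA n)); apply.
Qed.

(** The set of the points played by TWO in one run is a countable dense set. *)
Lemma TWO_wins_separable (X : topologicalType) :
  TWO_wins_G1 (@dense_sets X) (@dense_sets X) -> separable X.
Proof.
move=> [sg [_ sgB]].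
exists (range (fun n => sg (mkseq (fun=> setT) n.+1))).
  exact: card_image_le.
by apply: sgB => n; apply: dense_setT.
Qed.

Lemma markov_dense_of_pi_base (X : topologicalType) (u : nat -> set X) :
  pi_base (range u) -> TWO_wins_markov_G1 (@dense_sets X) (@dense_sets X).
Proof.
move=> pu; have [uo _] := pu.
have meet (A : set X) n : dense A -> exists y, (u n `&` A) y.
  by move=> dA; have [oU U0] := uo (u n) (imageT u n); apply: dA.
have [x0 _] := meet setT 0 (@dense_setT X).
have /choice[m mP] : forall p : set X * nat, exists y,
    dense p.1 -> (u p.2 `&` p.1) y.
  move=> [A n] /=; have [dA|ndA] := pselect (dense A); last by exists x0.
  by have [y] := meet A n dA; exists y.
exists (fun A n => m (A, n)); split=> [A n dA|A dA].
  by have [] := mP (A, n) dA.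
by apply: (dense_pi_base pu) => n; have [] := mP (A n, n) (dA n).
Qed.

(** * A countable pi-base from a strategy of TWO *)

(** Here [w s k] stands for a move that elicits, at position [s], the answer
    with index [k].  Indexing the positions by lists of indices leaves only
    countably many of them. *)
Definition position (M : Type) (w : seq M -> nat -> M) (t : seq nat) : seq M :=
  foldl (fun s k => rcons s (w s k)) [::] t.

Lemma position_rcons (M : Type) (w : seq M -> nat -> M) t k :
  position w (rcons t k) = rcons (position w t) (w (position w t) k).
Proof. by rewrite /position foldl_rcons. Qed.

(** A branch that follows indices chosen by [k] is a single run of the game. *)
Lemma position_run (M : Type) (w : seq M -> nat -> M) (k : seq nat -> nat) :
  exists (t : nat -> seq nat) (A : nat -> M),
    (forall n, mkseq A n = position w (t n)) /\
    (forall n, A n = w (position w (t n)) (k (t n))).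
Proof.
pose t := fix t n := if n is n'.+1 then rcons (t n') (k (t n')) else [::].
exists t, (fun n => w (position w (t n)) (k (t n))); split=> //.
by elim=> [//|n IHn]; rewrite mkseqS IHn /= position_rcons.
Qed.

(** Otherwise the points of the enumeration that ONE cannot elicit at [s] would
    form a dense set, and TWO's answer to this set would be both elicited and
    one of its points. *)
Lemma elicited_open (X : topologicalType) (d : nat -> X)
    (sg : seq (set X) -> X) (s : seq (set X)) :
  dense (range d) -> strategy (@dense_sets X) sg ->
  (forall B, B \in s -> dense B) ->
  exists O : set X, [/\ open O, O !=set0 &
    forall k, O (d k) -> exists2 A, dense A & sg (rcons s A) = d k].
Proof.
move=> dd sgA ds.
pose N := [set y | range d y /\
  ~ exists2 A, dense A & sg (rcons s A) = y].
have /denseNE[O [[y [oO Oy]] ON]] : ~ dense N.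
  move=> dN; have [_] := sgA s N ds dN.
  by apply; exists N.
exists O; split=> //; first by exists y.
move=> k Ok; apply: contrapT => nk.
by have : (O `&` N) (d k) by []; rewrite ON.
Qed.

(** The members of the local pi-base are the open sets of [elicited_open] at the
    positions of the countable tree.  A neighbourhood of [x] containing none of
    them would let ONE keep all the answers away from [x]. *)
Lemma countable_local_pi_base (X : topologicalType) (d : nat -> X) (x : X) :
  regular_space X -> dense (range d) -> TWO_wins_G1 dense_sets (Omega x) ->
  exists u : seq nat -> set X,
    (forall t, open (u t) /\ u t !=set0) /\
    (forall V, nbhs x V -> exists t, u t `<=` V).
Proof.
move=> reg dd [sg [sgA sgB]].
(* The move is dense even when [d k] cannot be elicited, so that every list of
   indices leads to a legal position. *)
have /choice[w' wP] : forall p : seq (set X) * nat, exists A, dense A /\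
    ((exists2 B, dense B & sg (rcons p.1 B) = d p.2) ->
     sg (rcons p.1 A) = d p.2).
  move=> [s k] /=.
  have [[A dA AE]|nA] := pselect (exists2 B, dense B & sg (rcons s B) = d k).
    by exists A.
  by exists setT; split=> [|/nA//]; apply: dense_setT.
pose w s k := w' (s, k).
have dpos t B : B \in position w t -> dense B.
  elim/last_ind: t B => [//|t k IHt] B.
  rewrite position_rcons mem_rcons inE => /orP[/eqP ->|/IHt//].
  by have [] := wP (position w t, k).
have /choice[u uP] t := elicited_open dd sgA (dpos t).
exists u; split=> [t|V xV]; first by have [] := uP t.
apply: contrapT => /forallNP uV.
have [W xW WV] := reg x V xV.
(* No [u t] is contained in [closure W], so at every position ONE can elicit an
   answer outside it. *)
have /choice[k kP] : forall t, exists k, u t (d k) /\ ~ closure W (d k).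
  move=> t; have [ou _ _] := uP t.
  have [y [uy nWy]] : u t `&` ~` closure W !=set0.
    apply: contrapT => nuW; apply: (uV t) => y uy; apply: WV.
    by apply: contrapT => nWy; apply: nuW; exists y.
  have oO : open (u t `&` ~` closure W).
    by apply: openI => //; apply/closed_openC/closed_closure.
  have [z [[uz nWz] [j _ djE]]] :=
    dd _ (ex_intro _ y (conj uy nWy)) oO.
  by exists j; rewrite djE.
have [t [A [posA AE]]] := position_run w k.
have dA n : dense (A n).
  by rewrite AE; have [] := wP (position w (t n), k (t n)).
have sgE n : sg (mkseq A n.+1) = d (k (t n)).
  rewrite mkseqS posA AE; have [_] := wP (position w (t n), k (t n)); apply.
  by have [_ _] := uP (t n); apply; have [] := kP (t n).
have out n : ~ W (sg (mkseq A n.+1)).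
  by rewrite sgE => /subset_closure; have [] := kP (t n).
have [[clx _]|rx] := sgB A dA.
  by have [_ [[n _ <-] Wn]] := clx W xW; exact: (out n).
have sx : sg (mkseq A 1) = x.
  by suff : [set x] (sg (mkseq A 1)) by []; rewrite -rx; exists 0.
by apply: (out 0); rewrite sx; apply: nbhs_singleton.
Qed.

Lemma countable_pi_base (X : topologicalType) (D : set X) :
  infinite_set [set: X] -> regular_space X -> countable D -> dense D ->
  (forall x, D x -> TWO_wins_G1 dense_sets (Omega x)) ->
  exists u : nat -> set X, pi_base (range u).
Proof.
move=> Xinf reg cD dD DO.
have /infinite_setN0 X0 := Xinf.
have [x0 [_ Dx0]] := dD setT X0 openT.
have [d dE] := countable_range cD (ex_intro _ x0 Dx0).
have dd : dense (range d) by rewrite dE.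
have /choice[u uP] : forall i, exists u : seq nat -> set X,
    (forall t, open (u t) /\ u t !=set0) /\
    (forall V, nbhs (d i) V -> exists t, u t `<=` V).
  move=> i; apply: (countable_local_pi_base reg dd); apply: DO.
  by rewrite -dE; exists i.
have [||f fE] := @countable_range _ (range (fun p => u p.1 p.2)).
- by apply: card_le_trans (countableP _); apply: card_image_le.
- by exists (u 0 [::]), (0, [::]).
exists f; rewrite fE; split=> [_ [[i t] _ <-]|V oV V0].
  by have [] := uP i.
have [y [Vy [i _ diE]]] := dd V V0 oV; subst y.
have [_ /(_ V)] := uP i; case=> [|t utV]; first exact: open_nbhs_nbhs.
by exists (u i t) => //; exists (i, t).
Qed.

Theorem corollary2p4 (X : topologicalType)
    (X_infinite : infinite_set [set: X])
    (X_regular : regular_space X)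
    (X_hausdorff : hausdorff_space X)
    (X_no_isolated : isolated [set: X] = set0) :
  [<-> pi_weight_is X [set: nat];
       TWO_wins_G1 (@dense_sets X) (@dense_sets X);
       TWO_wins_markov_G1 (@dense_sets X) (@dense_sets X);
       separable X /\ (forall x : X, TWO_wins_G1 dense_sets (Omega x));
       separable X /\ (forall x : X, TWO_wins_markov_G1 dense_sets (Omega x));
       (exists D : set X, [/\ countable D, dense D &
         forall x, D x -> TWO_wins_G1 dense_sets (Omega x)]);
       (exists D : set X, [/\ countable D, dense D &
         forall x, D x -> TWO_wins_markov_G1 dense_sets (Omega x)])].
Proof.
have T1 := hausdorff_accessible X_hausdorff.
have weight_markov : pi_weight_is X [set: nat] ->
    TWO_wins_markov_G1 (@dense_sets X) (@dense_sets X).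
  by move=> /(pi_weight_natP X_infinite T1)[u]; apply: markov_dense_of_pi_base.
have Omega_weight (D : set X) : countable D -> dense D ->
    (forall x, D x -> TWO_wins_G1 dense_sets (Omega x)) ->
    pi_weight_is X [set: nat].
  move=> cD dD DO; apply/(pi_weight_natP X_infinite T1).
  exact: (countable_pi_base X_infinite X_regular cD dD DO).
have markov_Omega : TWO_wins_markov_G1 (@dense_sets X) (@dense_sets X) ->
    separable X /\ (forall x : X, TWO_wins_markov_G1 dense_sets (Omega x)).
  move=> wm; split; first exact/TWO_wins_separable/TWO_wins_of_markov.
  by move=> x; apply: TWO_wins_markov_Omega.
tfae.
- by move=> /weight_markov/TWO_wins_of_markov.
- move=> ws; apply: weight_markov; have [D cD dD] := TWO_wins_separable ws.
  by apply: (Omega_weight D cD dD) => x _; apply: TWO_wins_Omega.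
- move=> /markov_Omega[sepX wm]; split=> // x; exact: TWO_wins_of_markov.
- move=> [[D cD dD] ws]; apply/markov_Omega/weight_markov.
  exact: (Omega_weight D cD dD).
- move=> [[D cD dD] wm]; exists D; split=> // x _; exact: TWO_wins_of_markov.
- move=> [D [cD dD /(Omega_weight D cD dD)/weight_markov/markov_Omega[_ wm]]].
  by exists D.
- move=> [D [cD dD wm]]; apply: (Omega_weight D cD dD) => x Dx.
  exact/TWO_wins_of_markov/wm.
Qed.
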